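(* $|\mathfrak{S}_1(132,\mathrm{A})|=1$, and for $n\ge 2$, $|\mathfrak{S}_n(132,\mathrm{A})|=C_n-C_{n-1}$.
   Context: $C_n=\frac{1}{n+1}\binom{2n}{n}$ is the $n$-th Catalan number. $\mathfrak{S}_n$ is the set of permutations $\sigma=\sigma_1\sigma_2\cdots\sigma_n$ of $[n]=\{1,\dots,n\}$ in one-line notation. A mesh pattern is a pair $p=(\pi,R)$ with $\pi\in\mathfrak{S}_m$ and $R\subseteq\{0,\dots,m\}\times\{0,\dots,m\}$ (the set of shaded unit cells, each given by its bottom-left corner, in the grid with dots at $(i,\pi_i)$). An occurrence of $p$ in $\sigma\in\mathfrak{S}_n$ is a choice of indices $i_1<\cdots<i_m$ such that $\sigma_{i_1}\cdots\sigma_{i_m}$ is order-isomorphic to $\pi$ and, for every $(a,b)\in R$, there is no index $r$ with $i_a<r<i_{a+1}$ and $v_b<\sigma_r<v_{b+1}$; here $v_1<\cdots<v_m$ is the increasing rearrangement of $\sigma_{i_1},\dots,\sigma_{i_m}$, $i_0=v_0=0$ and $i_{m+1}=v_{m+1}=n+1$. A classical pattern $\pi$ is the mesh pattern $(\pi,\varnothing)$. $\mathfrak{S}_n(p,q)$ is the set of permutations in $\mathfrak{S}_n$ with no occurrence of $p$ and no occurrence of $q$. Here $132$ is the classical pattern and $\mathrm{A}=(12,\{(0,2),(2,0)\})$. *)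

(* Defs.v *)
From mathcomp Require Import all_boot all_order all_fingroup all_algebra.

Set Implicit Arguments.
Unset Strict Implicit.
Unset Printing Implicit Defensive.

(* Permutations of [n] = {1, ..., n} are elements s of 'S_n, which act on
   {0, ..., n-1}: the usual 1-based entry in position i.+1 is (s i).+1. *)
Definition one_line n (s : 'S_n) : seq nat :=
  [seq (s i).+1 | i <- enum 'I_n].

(* A pair (a, b) in the shading is the unit cell with bottom-left corner (a, b),
   in the grid where the dots sit at the 1-based points (i.+1, (pi i).+1). *)
Record mesh_pattern := MeshPattern {
  mlen : nat;
  mperm : 'S_mlen;
  mshade : {set 'I_mlen.+1 * 'I_mlen.+1} }.

Definition classical m (pi : 'S_m) : mesh_pattern := MeshPattern pi set0.

Section Occurrence.
Variables (m n : nat) (s : 'S_n) (f : {ffun 'I_m -> 'I_n}).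

(* i_0 = 0, i_1 = (f 0).+1, ..., i_m = (f (m-1)).+1 and i_{m+1} = n+1, the
   latter being the default value of nth. *)
Definition occ_pos (a : nat) : nat :=
  nth n.+1 (0 :: [seq (f i).+1 | i <- enum 'I_m]) a.

(* Likewise v_0 = 0, v_1 < ... < v_m the sorted values, and v_{m+1} = n+1. *)
Definition occ_val (b : nat) : nat :=
  nth n.+1 (0 :: sort leq [seq (s (f i)).+1 | i <- enum 'I_m]) b.

Definition in_cell (a b : nat) (r : 'I_n) : bool :=
  (occ_pos a < r.+1 < occ_pos a.+1) && (occ_val b < (s r).+1 < occ_val b.+1).

End Occurrence.

Definition occurrence (p : mesh_pattern) n (s : 'S_n)
    (f : {ffun 'I_(mlen p) -> 'I_n}) : bool :=
  [&& [forall i : 'I_(mlen p), forall j : 'I_(mlen p), (i < j) ==> (f i < f j)],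
      [forall i : 'I_(mlen p), forall j : 'I_(mlen p),
         (s (f i) < s (f j)) == (mperm p i < mperm p j)] &
      [forall c in mshade p, ~~ [exists r, in_cell s f c.1 c.2 r]]].

Arguments occurrence p {n} s f.

Definition avoids n (s : 'S_n) (p : mesh_pattern) : bool :=
  ~~ [exists f : {ffun 'I_(mlen p) -> 'I_n}, occurrence p s f].

Definition avoiders2 n (p q : mesh_pattern) : {set 'S_n} :=
  [set s : 'S_n | avoids s p && avoids s q].

Definition perm132 : 'S_3 := tperm (inord 1) (inord 2).

Definition perm12 : 'S_2 := 1%g.

Lemma one_line_perm132 : one_line perm132 = [:: 1; 3; 2].
Proof.
by rewrite /one_line /perm132 !enum_ordSl enum_ord0 /= !permE /=
   -!val_eqE /= !inordK.
Qed.

Lemma one_line_perm12 : one_line perm12 = [:: 1; 2].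
Proof. by rewrite /one_line !enum_ordSl enum_ord0 /= !permE. Qed.

Definition pattern132 : mesh_pattern := classical perm132.

(* The shaded cells are (0, 2) and (2, 0). *)
Definition patternA : mesh_pattern :=
  @MeshPattern 2 perm12 [set (ord0, ord_max); (ord_max, ord0)].

Definition catalan (n : nat) : nat := 'C(2 * n, n) %/ n.+1.

(* The division above is exact. *)
Lemma catalanE n : n.+1 * catalan n = 'C(2 * n, n).
Proof.
rewrite /catalan mulnC divnK //.
have h : n.+1 * 'C(2 * n, n.+1) = n * 'C(2 * n, n).
  by rewrite mul_bin_left mul2n -addnn addnK.
by rewrite -(@Gauss_dvdr _ n) ?coprimeSn // -h dvdn_mulr.
Qed.

(* Main.v *)
Require Import Defs.
From mathcomp Require Import all_boot all_order all_fingroup all_algebra.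
From mathcomp Require Import zify.

Set Implicit Arguments.
Unset Strict Implicit.
Unset Printing Implicit Defensive.

(** Write a 132-avoiding permutation as L n R, where n is its maximal entry.
    Avoidance of 132 forces every entry of L to exceed every entry of R.
    Suppose that R is nonempty and consider an ascent pair x ... y.  If x lies
    in L, then y lies in L or is n, and an entry of R is to the right of y and
    below x; if x and y both lie in R, then n is to the left of x and above y.
    In each case a shaded cell of A is hit.  If R is empty, the pair formed by
    the minimal entry and n is an occurrence of A, as soon as there are two
    entries.  So, among the 132-avoiding permutations of length at least 2,
    those containing A are the ones ending with their maximum
    ([hasA_max_last]); deleting this maximum gives an arbitrary 132-avoiding
    permutation with one entry less, whence the subtracted Catalan number
    ([card_avoiders2]).

    It remains to count 132-avoiders ([num132_catalan]).  Let s have first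
    entry a and let t be the standardization of the rest, both with values
    counted from 0.  Then s avoids 132 iff t does and the entries of t that are
    at least a appear in increasing order; as t avoids 132 itself, this only
    says that the first entry of t is at most a ([has132_lift0]).  Hence the
    number of 132-avoiders whose first entry is at most a satisfies the
    recurrence of the ballot numbers ([num132_leS]), whose closed form is a
    difference of two binomial coefficients ([num132_le_ballot]). *)

(** * Containment of the two patterns *)

Definition has132 n (s : 'S_n) : Prop :=
  exists i j k : 'I_n, [/\ i < j, j < k, s i < s k & s k < s j].

Lemma avoids132P n (s : 'S_n) : reflect (~ has132 s) (avoids s pattern132).
Proof.
rewrite /avoids; apply: (iffP negP) => h; first last.
  move=> /existsP[f /and3P[/forallP hmono /forallP hiso _]].
  have mono (i j : 'I_3) : i < j -> f i < f j.
    exact: (implyP (forallP (hmono i) j)).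
  have iso (i j : 'I_3) : (s (f i) < s (f j)) = (perm132 i < perm132 j)
    by have /eqP := forallP (hiso i) j.
  apply: h; exists (f (inord 0 : 'I_3)), (f (inord 1 : 'I_3)), (f (inord 2 : 'I_3)).
  by split; rewrite ?mono ?iso ?inordK //= !permE /= -!val_eqE /= !inordK.
move=> [i [j [k [ij jk sik skj]]]]; apply: h; apply/existsP.
exists [ffun x : 'I_3 => nth i [:: i; j; k] x]; apply/and3P; split.
- apply/forallP=> x; apply/forallP=> y; rewrite !ffunE; apply/implyP.
  by case: x y => [[|[|[|//]]] ?] [[|[|[|//]]] ?] //= _; lia.
- apply/forallP=> x; apply/forallP=> y; rewrite !ffunE; apply/eqP.
  rewrite /= !permE /= -!val_eqE /= !inordK //.
  case: x y => [[|[|[|//]]] ?] [[|[|[|//]]] ?] //=; rewrite ?inordK //=; lia.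
- by apply/forallP=> c; rewrite inE.
Qed.

Definition hasA n (s : 'S_n) : Prop :=
  exists i j : 'I_n, [/\ i < j, s i < s j,
    forall r : 'I_n, r < i -> s r <= s j &
    forall r : 'I_n, j < r -> s i <= s r].

(** The sorted list of the two values of an ascent pair is the pair itself, so
    the bounds of a cell can be read off [f] directly. *)
Lemma in_cellA n (s : 'S_n) (f : {ffun 'I_2 -> 'I_n}) r :
    s (f ord0) < s (f ord_max) ->
  in_cell s f 0 2 r = (r < f ord0) && (s (f ord_max) < s r) /\
  in_cell s f 2 0 r = (f ord_max < r) && (s r < s (f ord0)).
Proof.
have -> : ord_max = lift ord0 ord0 :> 'I_2 by exact: val_inj.
move=> h; rewrite /in_cell /occ_pos /occ_val !enum_ordSl enum_ord0 /=.
by rewrite /sort /= (leqW h) /= !ltnS !ltn_ord !andbT.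
Qed.

Lemma avoidsAP n (s : 'S_n) : reflect (~ hasA s) (avoids s patternA).
Proof.
rewrite /avoids; apply: (iffP negP) => h; first last.
  move=> /existsP[f /and3P[/forallP hmono /forallP hiso /forallP hc]].
  have f01 : f ord0 < f ord_max by exact: (implyP (forallP (hmono ord0) ord_max)).
  have s01 : s (f ord0) < s (f ord_max).
    have /eqP -> := forallP (hiso ord0) ord_max.
    by rewrite /= !permE.
  apply: h; exists (f ord0), (f ord_max); split=> // r hr;
    rewrite leqNgt; apply/negP=> hs.
    have := hc (ord0, ord_max); rewrite !inE eqxx /= => /existsP[]; exists r.
    by rewrite (in_cellA _ s01).1 hr.
  have := hc (ord_max, ord0); rewrite !inE eqxx orbT /= => /existsP[]; exists r.
  by rewrite (in_cellA _ s01).2 hr.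
move=> [i [j [ij sij hl hr]]]; apply: h; apply/existsP.
pose f := [ffun x : 'I_2 => nth i [:: i; j] x].
have f0 : f ord0 = i by rewrite ffunE.
have f1 : f ord_max = j by rewrite ffunE.
have s01 : s (f ord0) < s (f ord_max) by rewrite f0 f1.
exists f; apply/and3P; split.
- apply/forallP=> x; apply/forallP=> y; rewrite !ffunE; apply/implyP.
  by case: x y => [[|[|//]] ?] [[|[|//]] ?].
- apply/forallP=> x; apply/forallP=> y; rewrite !ffunE; apply/eqP.
  rewrite /= !permE.
  case: x y => [[|[|//]] ?] [[|[|//]] ?] //=; lia.
- apply/forallP=> c; apply/implyP; rewrite !inE => /orP[] /eqP -> /=.
    apply/existsPn=> r; rewrite (in_cellA _ s01).1 f0 f1.
    by apply/negP=> /andP[/hl]; rewrite leqNgt => /negP.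
  apply/existsPn=> r; rewrite (in_cellA _ s01).2 f0 f1.
  by apply/negP=> /andP[/hr]; rewrite leqNgt => /negP.
Qed.

(** * Inserting an entry into a permutation *)

(** [lift_perm i j] inserts the value [j] at position [i] and shifts the other
    positions and values; it is a bijection onto the permutations sending [i]
    to [j], the preimage of [s] being obtained by deleting its entry [j]. *)
Lemma card_lift_perm n (i j : 'I_n.+1) (P : pred 'S_n.+1) :
  #|[set s | P s & s i == j]| = #|[set t | P (lift_perm i j t)]|.
Proof.
have inj : injective (lift_perm i j).
  move=> t u e; apply/permP => k; apply: (@lift_inj _ j).
  by rewrite -!(lift_perm_lift i j) e.
rewrite -(card_imset _ inj); apply: eq_card => s; rewrite !inE.
apply/andP/imsetP => [[Ps /eqP sij]|[t]]; last first.
  by rewrite inE => Pt ->; rewrite lift_perm_id.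
have skE k : exists l, s (lift i k) = lift j l.
  have : j != s (lift i k) by rewrite -sij (inj_eq perm_inj) neq_lift.
  by case/unlift_some=> l -> _; exists l.
have /fin_all_exists[t tE] := skE.
have inj_t : injective t.
  move=> k l e; apply: (@lift_inj _ i); apply: (@perm_inj _ s).
  by rewrite !tE e.
have sE : s = lift_perm i j (perm inj_t).
  apply/permP => k; case: (unliftP i k) => [l|] ->.
    by rewrite lift_perm_lift permE tE.
  by rewrite lift_perm_id.
by exists (perm inj_t); rewrite // inE -sE.
Qed.

(** A final maximum could only be the last entry of a 132, but that entry is
    below the middle one. *)
Lemma has132_lift_max n (t : 'S_n) :
  has132 (lift_perm ord_max ord_max t) <-> has132 t.
Proof.
split=> [[i [j [k [ij jk]]]]|[i [j [k [ij jk sik skj]]]]].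
  case: (unliftP ord_max k) jk => [k'|] -> jk; last first.
    by rewrite lift_perm_id => _; rewrite ltnNge -ltnS ltn_ord.
  case: (unliftP ord_max j) ij jk => [j'|] -> ij jk; last first.
    by move: jk; rewrite lift_max /= ltnNge (ltnW (ltn_ord k')).
  case: (unliftP ord_max i) ij => [i'|] -> ij; last first.
    by move: ij; rewrite lift_max /= ltnNge (ltnW (ltn_ord j')).
  by rewrite !lift_perm_lift !lift_max in ij jk * => ? ?; exists i', j', k'.
exists (lift ord_max i), (lift ord_max j), (lift ord_max k).
by rewrite !lift_perm_lift !lift_max.
Qed.

(** A 132 starting at the new first entry [a] amounts to a descent of [t] among
    the values that are at least [a].  If the first entry of [t] exceeds [a],
    such a descent leads from it to the value [a].  If not, the first entry of
    [t] is below any such descent, and forms a 132 in [t] with it. *)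
Lemma has132_lift0 n (a : 'I_n.+2) (t : 'S_n.+1) :
  has132 (lift_perm ord0 a t) <-> has132 t \/ a < t ord0.
Proof.
have ltE (x : 'I_n.+1) : (a < lift a x) = (a <= x).
  by rewrite /= /bump; case: leqP => /= ?; lia.
have lt2 (x y : 'I_n.+1) : (lift a x < lift a y) = (x < y).
  by rewrite /= /bump; case: leqP => /= ?; case: leqP => /= ?; lia.
split=> [[i [j [k [ij jk]]]]|[[i [j [k [ij jk sik skj]]]]|h]].
- case: (unliftP ord0 k) jk => [k'|] -> jk; last by [].
  case: (unliftP ord0 j) ij jk => [j'|] -> ij jk; last by [].
  rewrite !lift0 ltnS in jk.
  case: (unliftP ord0 i) ij => [i'|] -> ij.
    rewrite !lift0 ltnS in ij; rewrite !lift_perm_lift !lt2 => ? ?.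
    by left; exists i', j', k'.
  rewrite lift_perm_id !lift_perm_lift ltE lt2 => ak kj.
  case: (leqP (t ord0) a) => [ta|]; [left | by right].
  have k0 : t ord0 != t k' by rewrite (inj_eq perm_inj) -val_eqE /=; lia.
  have j0 : 0 < j' by case: (posnP j') => // e;
    have E : j' = ord0 by [exact: val_inj]; move: kj; rewrite E; lia.
  exists ord0, j', k'; split=> //.
  by move: k0; rewrite -val_eqE /=; lia.
- exists (lift ord0 i), (lift ord0 j), (lift ord0 k).
  by rewrite !lift_perm_lift !lt2 !lift0.
- have an : a < n.+1 by have := ltn_ord (t ord0); lia.
  (* The value a of t is preceded by the larger first entry of t. *)
  pose k := (t^-1)%g (Ordinal an).
  have tk : t k = Ordinal an by rewrite permKV.
  have k0 : 0 < k.
    case: (posnP k) => // e; have E : k = ord0 by [exact: val_inj].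
    by move: h; rewrite -E tk /= ltnn.
  exists ord0, (lift ord0 ord0), (lift ord0 k).
  by rewrite lift_perm_id !lift_perm_lift ltE lt2 !lift0 tk /=.
Qed.

(** * Counting the permutations that avoid 132 *)

Definition num132 n := #|[set s : 'S_n | avoids s pattern132]|.
Definition num132_le n a := #|[set s : 'S_n.+1 | avoids s pattern132 & s ord0 <= a]|.

Lemma avoids132_small n (s : 'S_n) : n <= 2 -> avoids s pattern132.
Proof.
move=> n2; apply/avoids132P => -[i [j [k [ij jk _ _]]]].
by have := ltn_ord k; lia.
Qed.

Lemma num132_le_total n a : n <= a -> num132 n.+1 = num132_le n a.
Proof.
move=> na; apply: eq_card => s; rewrite !inE.
by rewrite (leq_trans _ na) ?andbT // -ltnS ltn_ord.
Qed.

Lemma avoids132_lift0 n (a : 'I_n.+2) (t : 'S_n.+1) :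
  avoids (lift_perm ord0 a t) pattern132 = avoids t pattern132 && (t ord0 <= a).
Proof.
apply/avoids132P/andP=> [h|[/avoids132P h ta] /has132_lift0[//|]]; last by lia.
by split; [apply/avoids132P|rewrite leqNgt; apply/negP] => h';
  apply: h; apply/has132_lift0; [left|right].
Qed.

Lemma num132_first n (a : 'I_n.+2) :
  #|[set s : 'S_n.+2 | avoids s pattern132 & s ord0 == a]| = num132_le n a.
Proof.
rewrite card_lift_perm; apply: eq_card => t.
by rewrite !inE avoids132_lift0.
Qed.

Lemma num132_le0 n : num132_le n 0 = 1.
Proof.
elim: n => [|n <-].
  rewrite -(@num132_le_total 0 0) // /num132 -[RHS]/(1`!) -card_Sn; apply: eq_card => s.
  by rewrite inE avoids132_small.
rewrite -[RHS](@num132_first n ord0); apply: eq_card => s.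
by rewrite !inE leqn0.
Qed.

Lemma num132_leS n a : a <= n ->
  num132_le n.+1 a.+1 = num132_le n.+1 a + num132_le n a.+1.
Proof.
move=> an; have an2 : a.+1 < n.+2 by [].
rewrite -(num132_first (Ordinal an2)) /num132_le -cardsUI.
rewrite [X in _ = _ + X](_ : _ = 0) ?addn0.
  apply: eq_card => s; rewrite !inE -val_eqE /= leq_eqVlt ltnS.
  by case: avoids => //=; rewrite orbC.
apply/eqP; rewrite cards_eq0; apply/eqP/setP=> s; rewrite !inE -val_eqE /=.
by case: eqP => [->|]; rewrite ?ltnn ?andbF.
Qed.

(** The Pascal rule gives the two binomial coefficients the recurrence of
    [num132_leS].  That recurrence stops at [a = n], where
    [num132_le n n.+1 = num132_le n n]; the binomial coefficients that it would
    contribute there are symmetric to each other and cancel.  The bound is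
    written [a.+1] so that no lower index of a binomial is negative. *)
Lemma num132_le_ballot n a : a <= n ->
  num132_le n a.+1 + 'C(n + a.+2, a) = 'C(n + a.+2, a.+1).
Proof.
elim: n a => [|n IHn] a an.
  have -> : a = 0 by lia.
  rewrite -(@num132_le_total 0 1) // (@num132_le_total 0 0) // num132_le0.
  by [].
elim: a an => [_|a IHa an].
  rewrite num132_leS // num132_le0 bin0 bin1.
  by have := IHn 0 isT; rewrite bin0 bin1; lia.
have {}IHa := IHa (ltnW an).
case: (ltngtP a n) => [lt|gt|E]; last 2 first.
- by lia.
- subst a.
  rewrite -(@num132_le_total _ n.+2) // (@num132_le_total _ n.+1) //.
  have h1 : n.+1 + n.+3 = (n.+1 + n.+2).+1 by lia.
  have sym : 'C(n.+1 + n.+2, n.+2) = 'C(n.+1 + n.+2, n.+1).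
    by rewrite -bin_sub ?leq_addl // addnK.
  by move: h1 sym IHa; move: (n.+1 + n.+2) => N -> sym IHa; rewrite !binS; lia.
rewrite num132_leS; last by lia.
have h1 : n.+1 + a.+3 = (n.+1 + a.+2).+1 by lia.
have := IHn a.+1 lt; have <- : n.+1 + a.+2 = n + a.+3 by lia.
by move: h1 IHa; move: (n.+1 + a.+2) => N -> IHa IH; rewrite !binS; lia.
Qed.

Lemma num132_catalan n : num132 n = catalan n.
Proof.
case: n => [|n].
  rewrite /catalan /= -[RHS]/(0`!) -card_Sn; apply: eq_card => s.
  by rewrite inE avoids132_small.
have h : num132 n.+1 + 'C(2 * n.+1, n) = 'C(2 * n.+1, n.+1).
  have := num132_le_ballot (leqnn n).
  by rewrite -(@num132_le_total n n.+1) // (_ : n + n.+2 = 2 * n.+1) //; lia.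
have c := catalanE n.+1.
(* Together with h, this gives n.+2 * num132 n.+1 = 'C(2 * n.+1, n.+1). *)
have e : n.+2 * 'C(2 * n.+1, n) = n.+1 * 'C(2 * n.+1, n.+1).
  by rewrite mul_bin_left (_ : 2 * n.+1 - n = n.+2) //; lia.
nia.
Qed.

(** * Containing A amounts to ending with the maximum *)

(** With [k] the position of the maximum, avoidance of 132 puts every entry
    before [k] above every entry after it ([cross]). *)
Lemma hasA_max_last n (s : 'S_n.+2) : ~ has132 s ->
  hasA s <-> s ord_max = ord_max.
Proof.
move=> no132; split=> [[i [j [ij sij hl hr]]]|smax].
  pose k := (s^-1)%g ord_max.
  have sk : s k = ord_max by rewrite permKV.
  have lts (x : 'I_n.+2) : x != k -> s x < s k.
    move=> xk; rewrite sk ltn_neqAle -ltnS ltn_ord andbT.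
    apply: contra xk => /eqP e; rewrite -(inj_eq (@perm_inj _ s)) sk.
    exact/eqP/val_inj.
  have cross (x y : 'I_n.+2) : x < k -> k < y -> s y < s x.
    move=> xk ky; rewrite ltnNge; apply/negP=> xy; apply: no132; exists x, k, y.
    split=> //; last by apply: lts; rewrite -val_eqE /=; lia.
    rewrite ltn_neqAle xy andbT val_eqE (inj_eq perm_inj) -val_eqE /=; lia.
  suff kmax : k = ord_max by rewrite -{1}kmax.
  apply: val_inj; apply/eqP; apply/negPn/negP; rewrite /= => nk.
  have kn : k < n.+1 by have := ltn_ord k; lia.
  (* Otherwise the maximum is in the cell to the left of and above the pair. *)
  have ki : i <= k.
    rewrite leqNgt; apply/negP=> ki; have := hl _ ki.
    by rewrite leqNgt lts // -val_eqE /=; lia.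
  have ik : i < k.
    rewrite ltn_neqAle ki andbT; apply/eqP=> /val_inj E; move: sij; rewrite E.
    by rewrite ltnNge sk -ltnS ltn_ord.
  (* If j <= k, then the last entry is in the cell to the right of and below the
     pair. *)
  case: (ltnP k j) => [kj|jk]; first by have := cross _ _ ik kj; lia.
  have := hr ord_max (leq_ltn_trans jk kn); have := cross i ord_max ik kn; lia.
(* The minimum and the final maximum leave no room above or below the pair. *)
pose i := (s^-1)%g ord0.
have si : s i = ord0 by rewrite permKV.
have im : i < n.+1.
  rewrite ltn_neqAle -ltnS ltn_ord andbT; apply/eqP=> e.
  have E : i = ord_max by exact: val_inj.
  by move: smax; rewrite -E si E.
exists i, ord_max; split=> //; first by rewrite si smax.
  by move=> r _; rewrite smax -ltnS ltn_ord.
by move=> r _; rewrite si.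
Qed.

Lemma card_avoiders2 n :
  #|avoiders2 n.+2 pattern132 patternA| + num132 n.+1 = num132 n.+2.
Proof.
have -> : num132 n.+1 =
    #|[set s : 'S_n.+2 | avoids s pattern132 & s ord_max == ord_max]|.
  rewrite card_lift_perm; apply: eq_card => t; rewrite !inE.
  by apply/avoids132P/avoids132P => h /has132_lift_max.
rewrite /num132 -[RHS](cardsID [set s : 'S_n.+2 | s ord_max == ord_max]) addnC.
congr (_ + _); apply: eq_card => s; rewrite !inE // andbC.
case: (avoids132P s) => //= h; rewrite ?andbF ?andbT //.
by apply/avoidsAP/negP => h' => [/eqP|] e; apply: h';
  [|apply/eqP]; apply/hasA_max_last.
Qed.

(* The difference of Catalan numbers is taken in int, so it is not truncated. *)
Theorem theorem4p1 :
  #|avoiders2 1 pattern132 patternA| = 1%N /\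
  (forall n : nat, (2 <= n)%N ->
    (Posz #|avoiders2 n pattern132 patternA| =
       Posz (catalan n) - Posz (catalan (n - 1)))%R).
Proof.
split=> [|[|[|n]] // _].
  rewrite -[RHS]/(1`!) -card_Sn; apply: eq_card => s; rewrite !inE avoids132_small //=.
  by apply/avoidsAP => -[i [j [ij _ _ _]]]; have := ltn_ord j; lia.
by rewrite subn1 /= -!num132_catalan -card_avoiders2 PoszD GRing.addrK.
Qed.
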